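(* Let $\mu$ be an $L$-subgroup of $G$ and let $\lambda=\bigcup\{a_x : a_x\text{ is a non-generator of }\mu\}$ be the $L$-subgroup of non-generators of $\mu$. Then $\lambda\subseteq\Phi(\mu)$. Equality $\lambda=\Phi(\mu)$ holds if $L$ is an upper well ordered chain.
   Context: $L$ is a completely distributive (complete) lattice with least element $0$ and greatest element $1$; $G$ is a group with identity $e$. A chain $L$ is upper well ordered if every non-empty subset of $L$ contains its supremum. An $L$-subset of $G$ is a function $G\to L$; $\eta\subseteq\mu$ means $\eta(x)\le\mu(x)$ for all $x\in G$; unions and intersections of $L$-subsets are pointwise joins and meets. An $L$-subset $\mu$ of $G$ is an $L$-subgroup of $G$ if $\mu(xy)\ge\mu(x)\wedge\mu(y)$ and $\mu(x^{-1})=\mu(x)$ for all $x,y\in G$. $L^\mu$ is the set of all $L$-subsets $\eta$ of $G$ with $\eta\subseteq\mu$, and $L(\mu)$ the set of $L$-subgroups $\eta$ of $G$ with $\eta\subseteq\mu$ (called $L$-subgroups of $\mu$). An $\eta\in L(\mu)$ is proper if $\eta$ is non-constant and $\eta\neq\mu$. A proper $L$-subgroup $\eta$ of $\mu$ is a maximal $L$-subgroup of $\mu$ if whenever $\eta\subseteq\theta\subseteq\mu$ with $\theta\in L(\mu)$, then $\theta=\eta$ or $\theta=\mu$. The Frattini $L$-subgroup $\Phi(\mu)$ is the intersection of all maximal $L$-subgroups of $\mu$, with $\Phi(\mu)=\mu$ if $\mu$ has no maximal $L$-subgroups. For $a\in L$, $x\in G$, the $L$-point $a_x$ is the $L$-subset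 with $a_x(x)=a$ and $a_x(y)=0$ for $y\ne x$; $a_x\in\mu$ means $\mu(x)\ge a$. For an $L$-subset $\eta$ of $G$, $\langle\eta\rangle$ is the smallest $L$-subgroup of $G$ containing $\eta$, and $\langle\eta,a_x\rangle=\langle\eta\cup a_x\rangle$. An $L$-point $a_x\in\mu$ is a non-generator of $\mu$ if for every $\eta\in L^\mu$, $\langle\eta,a_x\rangle=\mu$ implies $\langle\eta\rangle=\mu$.
   Formalization: Equality is proved only when it is not the case that μ is constant c off the identity with μ(e) covering c. In that case equality always fails over a chain, e.g. L={0,1}, μ the indicator of {e}: Φ(μ)=μ but λ=0. *)

(* Defs.v *)
From HB Require Import structures.
From mathcomp Require Import all_boot all_order.
From mathcomp Require Import boolp classical_sets.

Set Implicit Arguments.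
Unset Strict Implicit.
Unset Printing Implicit Defensive.

Import Order.TTheory.
Local Open Scope classical_set_scope.
Local Open Scope order_scope.

Definition complete_lattice d (L : tbLatticeType d) : Prop :=
  forall A : set L, supremums A !=set0 /\ infimums A !=set0.

(* The default values make these correct on the empty set as well. *)
Definition lsup d (L : tbLatticeType d) (A : set L) : L := supremum \bot A.
Definition linf d (L : tbLatticeType d) (A : set L) : L := infimum \top A.

(* For every family (J i) of subsets of L, the meet of the joins of the J i is
   the join, over all choice functions f, of the meets of the f i. *)
Definition completely_distributive d (L : tbLatticeType d) : Prop :=
  forall (I : Type) (J : I -> set L),
    linf [set lsup (J i) | i in [set: I]] =
    lsup [set linf (range f) | f in [set f : I -> L | forall i, J i (f i)]].

Definition upper_well_ordered_chain d (L : tbLatticeType d) : Prop :=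
  total (<=%O : rel L) /\ forall A : set L, A !=set0 -> A (lsup A).

Section LSubsets.
Context d (L : tbLatticeType d) (G : groupType).
Local Open Scope group_scope.
Implicit Types (mu eta theta : G -> L) (F : set (G -> L)) (a c : L) (x y : G).

Definition Lsubset eta mu : Prop := forall x, eta x <= mu x.

Definition Lcup eta mu : G -> L := fun x => Order.join (eta x) (mu x).
Definition Lbigcup F : G -> L := fun x => lsup [set eta x | eta in F].
Definition Lbigcap F : G -> L := fun x => linf [set eta x | eta in F].

Definition Lsubgroup mu : Prop :=
  (forall x y, Order.meet (mu x) (mu y) <= mu (x * y)) /\
  (forall x, mu x^-1 = mu x).

Definition Lsubgroup_of mu eta : Prop := Lsubgroup eta /\ Lsubset eta mu.

Definition proper_Lsubgroup mu eta : Prop :=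
  [/\ Lsubgroup_of mu eta, ~ (exists c, forall x, eta x = c) & eta <> mu].

Definition maximal_Lsubgroup mu eta : Prop :=
  proper_Lsubgroup mu eta /\
  forall theta, Lsubgroup_of mu theta -> Lsubset eta theta ->
    theta = eta \/ theta = mu.

Definition Frattini mu : G -> L :=
  if `[< exists eta, maximal_Lsubgroup mu eta >]
  then Lbigcap (maximal_Lsubgroup mu) else mu.

Definition Lpoint a x : G -> L := fun y => if `[< y = x >] then a else \bot.

(* The intersection is itself an L-subgroup (Lsubgroup_Lgen), hence the
   smallest one containing eta (sub_Lgen, Lgen_min). *)
Definition Lgen eta : G -> L :=
  Lbigcap [set theta | Lsubgroup theta /\ Lsubset eta theta].

Definition nongenerator mu a x : Prop :=
  a <= mu x /\
  forall eta, Lsubset eta mu -> Lgen (Lcup eta (Lpoint a x)) = mu ->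
    Lgen eta = mu.

(* An L-subgroup of mu: see nongenerators_Lsubgroup. *)
Definition nongenerators mu : G -> L :=
  Lbigcup [set eta | exists a x, nongenerator mu a x /\ eta = Lpoint a x].

(* mu takes the value c everywhere except at 1, and mu 1 covers c.  Over a
   chain, every L-subgroup of mu with a smaller value at 1 then lies below the
   constant c, which is not proper, so Frattini mu 1 = mu 1; but the L-point of
   height mu 1 at 1 is not a non-generator, since adding it to the constant c
   generates mu.  Hence nongenerators mu <> Frattini mu (see
   constant_below_tip_nongenerators).  The smallest instance is L = bool with
   mu the indicator function of [set 1], for any G. *)
Definition constant_below_tip mu : Prop :=
  exists c, [/\ c < mu 1, (forall b, c < b -> b <= mu 1 -> b = mu 1) &
                forall x, x <> 1 -> mu x = c].

End LSubsets.

Section Lemmas.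
Context d (L : tbLatticeType d) (G : groupType).
Context (cL : complete_lattice L).
Local Open Scope group_scope.
Implicit Types (mu eta theta : G -> L) (F : set (G -> L)) (A : set L).

Lemma lsupP A : supremums A (lsup A).
Proof.
rewrite /lsup /supremum; case: ifPn => [/eqP ->|_].
  by split=> [x //|x _]; exact: le0x.
by case: xgetP => [y _ //|/(_ _) h]; have [[y /h]] := cL A.
Qed.

Lemma linfP A : infimums A (linf A).
Proof.
rewrite /linf /infimum; case: ifPn => [/eqP ->|_].
  by split=> [x //|x _]; exact: lex1.
by case: xgetP => [y _ //|/(_ _) h]; have [_ [y /h]] := cL A.
Qed.

Lemma lsup_ub A x : A x -> x <= lsup A.
Proof. by move=> Ax; apply: (lsupP A).1. Qed.

Lemma lsup_le A b : (forall x, A x -> x <= b) -> lsup A <= b.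
Proof. by move=> h; apply: (lsupP A).2. Qed.

Lemma linf_lb A x : A x -> linf A <= x.
Proof. by move=> Ax; apply: (linfP A).1. Qed.

Lemma le_linf A b : (forall x, A x -> b <= x) -> b <= linf A.
Proof. by move=> h; apply: (linfP A).2. Qed.

Lemma Lbigcup_ub F eta : F eta -> Lsubset eta (Lbigcup F).
Proof. by move=> Fe x; apply: lsup_ub; exists eta. Qed.

Lemma Lbigcap_lb F eta : F eta -> Lsubset (Lbigcap F) eta.
Proof. by move=> Fe x; apply: linf_lb; exists eta. Qed.

Lemma Lsubset_anti eta theta :
  Lsubset eta theta -> Lsubset theta eta -> eta = theta.
Proof. by move=> h k; apply/funext => x; apply/le_anti; rewrite h k. Qed.

Lemma Lsubgroup_Lbigcap F :
  (forall eta, F eta -> Lsubgroup eta) -> Lsubgroup (Lbigcap F).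
Proof.
move=> h; split=> [x y|x].
  apply: le_linf => _ [eta Fe <-]; apply: le_trans ((h _ Fe).1 x y).
  by rewrite leI2 //; exact: Lbigcap_lb.
congr linf; apply/seteqP; split=> _ [eta Fe <-]; exists eta => //;
  by rewrite (h _ Fe).2.
Qed.

Lemma Lsubgroup_Lgen eta : Lsubgroup (Lgen eta).
Proof. by apply: Lsubgroup_Lbigcap => theta []. Qed.

Lemma sub_Lgen eta : Lsubset eta (Lgen eta).
Proof. by move=> x; apply: le_linf => _ [theta [_ h] <-]. Qed.

Lemma Lgen_min eta theta :
  Lsubgroup theta -> Lsubset eta theta -> Lsubset (Lgen eta) theta.
Proof. by move=> h k; apply: Lbigcap_lb. Qed.

Lemma Lsubgroup_cst c : @Lsubgroup _ L G (fun=> c).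
Proof. by split=> // x y; rewrite meetxx. Qed.

Lemma Lsubgroup_1 mu x : Lsubgroup mu -> mu x <= mu 1.
Proof. by case=> h k; have := h x x^-1; rewrite k meetxx mulgV. Qed.

Lemma Lpointxx a (x : G) : Lpoint a x x = a :> L.
Proof. by rewrite /Lpoint asboolT. Qed.

Lemma Lcup_sub eta theta mu :
  Lsubset eta mu -> Lsubset theta mu -> Lsubset (Lcup eta theta) mu.
Proof. by move=> h k x; rewrite leUx h k. Qed.

Lemma Lpoint_sub mu a x : a <= mu x -> Lsubset (Lpoint a x) mu.
Proof. by move=> h y; rewrite /Lpoint; case: asboolP => [->|]. Qed.

Lemma Lgen_id eta : Lsubgroup eta -> Lgen eta = eta.
Proof.
by move=> h; apply: Lsubset_anti; [exact: Lgen_min|exact: sub_Lgen].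
Qed.

Lemma chain_ltNge (a b : L) : total (<=%O : rel L) -> ~ a <= b -> b < a.
Proof.
move=> Ltot h; rewrite lt_def; case/orP: (Ltot a b) (h) => // -> _.
by rewrite andbT; apply/eqP => e; apply: h; rewrite e.
Qed.

(* The equality of nongenerators mu and Frattini mu really needs the exclusion
   of constant_below_tip. *)
Lemma constant_below_tip_nongenerators mu :
  total (<=%O : rel L) -> Lsubgroup mu -> constant_below_tip mu ->
  nongenerators mu <> Frattini mu.
Proof.
move=> Ltot mu_sub [c [c_mu cov mu_c]] eqmu.
have cst_mu : @Lsubgroup_of _ L G mu (fun=> c).
  split; first exact: Lsubgroup_cst.
  by move=> x; case: (pselect (x = 1)) => [->|/mu_c ->//]; exact: ltW.
have cst_neq : (fun=> c) <> mu by move=> e; move: c_mu; rewrite -e ltxx.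
suff : nongenerators mu 1 <= c /\ mu 1 <= Frattini mu 1.
  rewrite eqmu => -[h /le_trans/(_ h)/(lt_le_trans c_mu)].
  by rewrite ltxx.
split.
  apply: lsup_le => _ [_ [a [x [[amu anon] ->]]] <-].
  rewrite /Lpoint; case: asboolP => [x1|_]; last exact: le0x.
  subst x; apply: contrapT => /(chain_ltNge Ltot) ca; apply: cst_neq.
  have {ca} a_mu : a = mu 1 := cov _ ca amu.
  rewrite -(Lgen_id (Lsubgroup_cst c)); apply: anon; first exact: cst_mu.2.
  apply: Lsubset_anti.
    apply: Lgen_min => //; apply: Lcup_sub; first exact: cst_mu.2.
    exact: Lpoint_sub.
  move=> x; apply: le_trans (sub_Lgen _ x); rewrite /Lcup.
  have [->|/mu_c ->] := pselect (x = 1); last exact: leUl.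
  by rewrite Lpointxx a_mu leUr.
rewrite /Frattini; case: asboolP => // _.
apply: le_linf => _ [eta [[[eta_sub eta_mu] eta_ncst eta_neq] eta_max] <-].
apply: contrapT => /(chain_ltNge Ltot) lt1.
have eta_c x : eta x <= c.
  apply: le_trans (Lsubgroup_1 x eta_sub) _.
  apply: contrapT => /(chain_ltNge Ltot) /cov/(_ (ltW lt1)) e.
  by move: lt1; rewrite e ltxx.
have [e|//] := eta_max _ cst_mu eta_c.
by apply: eta_ncst; exists c; rewrite -e.
Qed.

Lemma lsup_meet A b : completely_distributive L ->
  Order.meet (lsup A) b <= lsup [set Order.meet a b | a in A].
Proof.
move=> cd; pose J (i : bool) := if i then A else [set b].
apply: (@le_trans _ _ (linf [set lsup (J i) | i in [set: bool]])).
  apply: le_linf => _ [[] _ <-] /=; first exact: leIl.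
  by apply: leIxr; exact: lsup_ub.
rewrite cd; apply: lsup_le => _ [f /= Jf <-].
apply: (@le_trans _ _ (Order.meet (f true) b)).
  rewrite lexI linf_lb /=; last by exists true.
  by have /= <- := Jf false; apply: linf_lb; exists false.
by apply: lsup_ub; exists (f true) => //; exact: (Jf true).
Qed.

Lemma nongenerators_Lsubgroup mu : completely_distributive L ->
  Lsubgroup mu -> Lsubgroup_of mu (nongenerators mu).
Proof.
move=> cd mu_sub.
have le_non x b : (forall a, nongenerator mu a x -> a <= b) ->
    nongenerators mu x <= b.
  move=> h; apply: lsup_le => _ [_ [a [y [an ->]]] <-].
  rewrite /Lpoint; case: asboolP => [e|_]; last exact: le0x.
  by subst y; exact: h.
have non_le a x : nongenerator mu a x -> a <= nongenerators mu x.
  move=> h; rewrite -[leLHS](Lpointxx a x).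
  by apply: (@Lbigcup_ub _ (Lpoint a x)); exists a, x.
have nonV a x : nongenerator mu a x -> nongenerator mu a x^-1.
  move=> [amu h]; split; first by rewrite mu_sub.2.
  move=> eta emu e; apply: h => //; rewrite -{}e.
  by apply: Lsubset_anti; (apply: Lgen_min; first exact: Lsubgroup_Lgen);
    apply: Lcup_sub;
    try (by move=> y; apply: le_trans (sub_Lgen _ y); exact: leUl);
    apply: Lpoint_sub; [rewrite -(Lsubgroup_Lgen _).2|
                        rewrite (Lsubgroup_Lgen _).2];
    apply: le_trans (sub_Lgen _ _); rewrite /Lcup Lpointxx leUr.
have nonM a b x y : nongenerator mu a x -> nongenerator mu b y ->
    nongenerator mu (Order.meet a b) (x * y).
  move=> [amu anon] [bmu bnon]; split.
    by apply: le_trans (mu_sub.1 x y); rewrite leI2.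
  move=> eta emu e; apply: anon => //; apply: bnon.
    by apply: Lcup_sub => //; exact: Lpoint_sub.
  set theta := Lgen _.
  have theta_sub : Lsubgroup theta by exact: Lsubgroup_Lgen.
  have eta_le : Lsubset eta theta.
    by move=> z; apply: le_trans (sub_Lgen _ z); rewrite /Lcup -joinA leUl.
  have a_le : a <= theta x.
    apply: le_trans (sub_Lgen _ x); rewrite /Lcup Lpointxx.
    by rewrite -joinA joinCA leUl.
  have b_le : b <= theta y.
    by apply: le_trans (sub_Lgen _ y); rewrite /Lcup Lpointxx leUr.
  apply: Lsubset_anti.
    apply: Lgen_min => //; apply: Lcup_sub; last exact: Lpoint_sub.
    by apply: Lcup_sub => //; exact: Lpoint_sub.
  rewrite -e; apply: Lgen_min => //; apply: Lcup_sub => //.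
  apply: Lpoint_sub; apply: le_trans (theta_sub.1 x y); by rewrite leI2.
have VK x : nongenerators mu x <= nongenerators mu x^-1.
  by apply: le_non => a /nonV /non_le.
split; last by move=> x; apply: le_non => a [].
split=> [x y|x]; last first.
  by apply/le_anti; rewrite VK andbT -[X in _ <= nongenerators _ X]invgK VK.
rewrite {1}/nongenerators /Lbigcup; apply: le_trans (lsup_meet _ _ cd) _.
apply: lsup_le => _ [_ [_ [a [z [an ->]]] <-] <-].
rewrite /Lpoint; case: asboolP => [e|_]; last by rewrite meet0x le0x.
subst z; rewrite meetC; apply: le_trans (lsup_meet _ _ cd) _.
apply: lsup_le => _ [_ [_ [b [z [bn ->]]] <-] <-].
rewrite /Lpoint; case: asboolP => [e|_]; last by rewrite meet0x le0x.
by subst z; rewrite meetC; apply: non_le; exact: nonM.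
Qed.

End Lemmas.

(* Main.v *)
(** Zorn's lemma gives, among the L-subgroups of [mu] containing [eta] whose
    value at [x] is not above [a], a maximal one [theta]; sups being attained is
    what keeps the value at [x] away from [a] along chains.  If [mu] is
    generated by [eta] and the L-point [a] at [x], every strictly larger
    L-subgroup of [mu] is [mu], so [theta] is a maximal L-subgroup unless it is
    a constant [c].  In that case raising the value of [theta] at [1] to any
    [b] with [c < b <= mu 1] already yields [mu], so [mu] is constant below its
    tip.  For [a = Frattini mu x] both outcomes are excluded. *)
Require Import Defs.
From HB Require Import structures.
From mathcomp Require Import all_boot all_order.
From mathcomp Require Import boolp classical_sets.

Set Implicit Arguments.
Unset Strict Implicit.
Unset Printing Implicit Defensive.

Import Order.TTheory.

Section Frattini.
Context d (L : tbLatticeType d) (G : groupType).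
Context (cL : complete_lattice L).
Local Open Scope classical_set_scope.
Local Open Scope order_scope.
Local Open Scope group_scope.
Implicit Types (mu eta theta : G -> L) (F : set (G -> L)) (a b c : L) (x : G).

Lemma Lgen_Lcup_Lpoint_min eta theta a x :
  Lsubgroup theta -> Lsubset eta theta -> a <= theta x ->
  Lsubset (Lgen (Lcup eta (Lpoint a x))) theta.
Proof.
move=> theta_sub eta_le a_le; apply: (Lgen_min cL) => //.
by apply: Lcup_sub => //; exact: Lpoint_sub.
Qed.

(** Adjoining the L-point to [eta] gives [eta] or [mu] by maximality. The first outcome is the
    claim; the second would force [eta], which generates itself, to equal [mu]. *)
Lemma nongenerator_le_maximal mu eta a x :
  Lsubgroup mu -> nongenerator mu a x -> maximal_Lsubgroup mu eta ->
  a <= eta x.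
Proof.
move=> mu_sub [a_mu non] [[[eta_sub eta_mu] _ eta_neq] eta_max].
have [e|e] := eta_max (Lgen (Lcup eta (Lpoint a x))) (conj
    (Lsubgroup_Lgen cL _) (Lgen_Lcup_Lpoint_min mu_sub eta_mu a_mu))
    (fun y => le_trans (leUl _ _) (sub_Lgen cL _ y)).
  rewrite -e; apply: le_trans (sub_Lgen cL _ x).
  by rewrite /Lcup Lpointxx leUr.
by case: eta_neq; rewrite -(Lgen_id cL eta_sub) non.
Qed.

Lemma Frattini_sub_maximal mu eta :
  maximal_Lsubgroup mu eta -> Lsubset (Frattini mu) eta.
Proof.
move=> eta_max; rewrite /Frattini asboolT; last by exists eta.
exact: (Lbigcap_lb cL).
Qed.

Lemma Frattini_sub mu : Lsubset (Frattini mu) mu.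
Proof.
have [[eta eta_max] y|no_max] := pselect (exists eta, maximal_Lsubgroup mu eta).
  apply: le_trans (Frattini_sub_maximal eta_max y) _.
  by have [[[_ eta_mu] _ _] _] := eta_max.
by rewrite /Frattini asboolF.
Qed.

Lemma nongenerators_sub_Frattini mu :
  Lsubgroup mu -> Lsubset (nongenerators mu) (Frattini mu).
Proof.
move=> mu_sub x; apply: (lsup_le cL) => _ [_ [a [y [an ->]]] <-].
rewrite /Lpoint; case: asboolP => [e|_]; last exact: le0x.
subst y; rewrite /Frattini; case: asboolP => [_|_]; last exact: an.1.
apply: (le_linf cL) => _ [eta eta_max <-].
exact: nongenerator_le_maximal an eta_max.
Qed.

Lemma nongenerator_le mu a x : nongenerator mu a x -> a <= nongenerators mu x.
Proof.
move=> an; rewrite -[leLHS](Lpointxx a x).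
by apply: (Lbigcup_ub cL (eta := Lpoint a x)); exists a, x.
Qed.

Section UpperWellOrdered.
Context (wo : upper_well_ordered_chain L).

Lemma Lbigcup_attained F x :
  F !=set0 -> exists2 eta, F eta & Lbigcup F x = eta x.
Proof.
move=> [eta0 Feta0].
have [|eta Feta e] := wo.2 [set eta x | eta in F]; last by exists eta.
by exists (eta0 x), eta0.
Qed.

(** The values of the union at [x] and [y] are attained by two members of [F]; the larger of the two
    bounds both values, so its own product inequality suffices. *)
Lemma Lsubgroup_Lbigcup_chain F :
  F !=set0 -> total_on F (@Lsubset _ L G) ->
  (forall eta, F eta -> Lsubgroup eta) -> Lsubgroup (Lbigcup F).
Proof.
move=> F0 Ftot Fsub; split=> [x y|x]; last first.
  by congr lsup; apply/seteqP; split=> _ [eta Feta <-]; exists eta => //;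
    rewrite (Fsub _ Feta).2.
have [eta Feta ->] := Lbigcup_attained x F0.
have [theta Ftheta ->] := Lbigcup_attained y F0.
have [le|le] := Ftot _ _ Feta Ftheta.
  apply: le_trans (Lbigcup_ub cL Ftheta _).
  by apply: le_trans ((Fsub _ Ftheta).1 x y); rewrite leI2.
apply: le_trans (Lbigcup_ub cL Feta _).
by apply: le_trans ((Fsub _ Feta).1 x y); rewrite leI2.
Qed.

Lemma maximal_avoiding_Lpoint mu eta a x :
  Lsubgroup_of mu eta -> ~ a <= eta x ->
  exists theta, [/\ Lsubgroup_of mu theta, Lsubset eta theta, ~ a <= theta x &
    forall theta', Lsubgroup_of mu theta' -> Lsubset theta theta' ->
      ~ a <= theta' x -> theta' = theta].
Proof.
move=> eta_of eta_x.
pose P theta := [/\ Lsubgroup_of mu theta, Lsubset eta theta & ~ a <= theta x].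
have Peta : P eta by split=> // y.
pose R (s t : {theta | P theta}) := `[< Lsubset (sval s) (sval t) >].
have [|||A Atot|[theta Ptheta] theta_max] := @Zorn {theta | P theta} R.
- by move=> s; apply/asboolP => y.
- move=> s t u /asboolP st /asboolP tu; apply/asboolP => y.
  exact: le_trans (st y) (tu y).
- by move=> [s Ps] [t Pt] /asboolP st /asboolP ts; exact/eq_exist/Lsubset_anti.
- have [[t At]|A0] := pselect (A !=set0); last first.
    by exists (exist _ eta Peta) => s As; case: A0; exists s.
  pose F := [set sval s | s in A].
  have F0 : F !=set0 by exists (sval t), t.
  have FP theta : F theta -> P theta by move=> [s _ <-]; exact: svalP s.
  suff PF : P (Lbigcup F).
    exists (exist _ _ PF) => s As; apply/asboolP.
    by apply: (Lbigcup_ub cL); exists s.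
  split.
  + split; last first.
      by move=> y; have [th /FP[[_ ?] _ _] ->] := Lbigcup_attained y F0.
    apply: Lsubgroup_Lbigcup_chain => // [_ _ [s As <-] [u Au <-]|th /FP[[]]//].
    by have [/asboolP|/asboolP] := Atot _ _ As Au; [left|right].
  + have [_ eta_t _] := svalP t.
    move=> y; apply: le_trans (eta_t y) _.
    by apply: (Lbigcup_ub cL (eta := sval t)); exists t.
  + by have [th /FP[_ _ ?] ->] := Lbigcup_attained x F0.
have [theta_of eta_theta theta_x] := Ptheta.
exists theta; split=> // theta' of' le' x'.
have P' : P theta' by split=> // y; exact: le_trans (eta_theta y) (le' y).
by have /(congr1 sval) := theta_max (exist _ _ P') (asboolT le').
Qed.

End UpperWellOrdered.

Lemma Lsubgroup_raise_tip b c :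
  c <= b -> Lsubgroup (Lcup (fun=> c) (Lpoint b (1 : G))).
Proof.
move=> cb; set theta := Lcup _ _.
have theta1 : theta 1 = b by rewrite /theta /Lcup Lpointxx; exact: join_r.
have thetaN1 x : x <> 1 -> theta x = c.
  by move=> x1; rewrite /theta /Lcup /Lpoint asboolF// joinx0.
have c_le x : c <= theta x by exact: leUl.
split=> [x y|x].
  have [->|/thetaN1 ->] := pselect (x = 1); last by rewrite leIxl.
  by rewrite mul1g leIr.
have [->|x1] := pselect (x = 1); first by rewrite invg1.
by rewrite !thetaN1// => /(congr1 (@inv G)); rewrite invgK invg1.
Qed.

(** For [c < b <= mu 1], the constant [c] raised to [b] at [1] lies strictly above the constant,
    hence is [mu]. Reading this at [1] gives [b = mu 1]; reading it elsewhere gives the value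
    [c]. *)
Lemma constant_maximal_constant_below_tip mu c :
  (forall x, c <= mu x) -> c < mu 1 ->
  (forall theta, Lsubgroup_of mu theta -> Lsubset (fun=> c) theta ->
    theta = (fun=> c) \/ theta = mu) ->
  constant_below_tip mu.
Proof.
move=> c_mu c_lt c_max.
have raise b : c < b -> b <= mu 1 -> Lcup (fun=> c) (Lpoint b 1) = mu.
  move=> cb b_mu; case: (c_max (Lcup (fun=> c) (Lpoint b 1))) => //.
  - split; first exact: Lsubgroup_raise_tip (ltW cb).
    by apply: Lcup_sub => //; exact: Lpoint_sub.
  - by move=> x; exact: leUl.
  - move=> /(congr1 (fun f => f 1)) /=; rewrite /Lcup Lpointxx => /join_idPl bc.
    by have := lt_le_trans cb bc; rewrite ltxx.
exists c; split=> // [b cb b_mu|x x1].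
  by rewrite -(raise b)// /Lcup Lpointxx; rewrite join_r// ltW.
by rewrite -(raise (mu 1))// /Lcup /Lpoint asboolF// joinx0.
Qed.

(** This yields the reverse inclusion directly: [Frattini mu x] becomes one of the heights joined in
    [nongenerators mu x]. *)
Lemma Frattini_nongenerator mu x :
  upper_well_ordered_chain L -> Lsubgroup mu -> ~ constant_below_tip mu ->
  nongenerator mu (Frattini mu x) x.
Proof.
move=> wo mu_sub not_tip; split; first exact: Frattini_sub.
set a := Frattini mu x => eta eta_mu gen_mu.
(* Such a [theta] contains a generating family of [mu]. *)
have above theta : Lsubgroup_of mu theta -> Lsubset eta theta ->
    a <= theta x -> theta = mu.
  move=> [theta_sub theta_mu] eta_theta a_theta; apply: Lsubset_anti => //.
  by rewrite -gen_mu; exact: Lgen_Lcup_Lpoint_min.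
have gen_of : Lsubgroup_of mu (Lgen eta).
  by split; [exact: Lsubgroup_Lgen|exact: Lgen_min].
have [/above->//|gen_x] := pselect (a <= Lgen eta x).
  exact: sub_Lgen.
have [theta [theta_of gen_theta theta_x theta_max]] :=
  maximal_avoiding_Lpoint wo gen_of gen_x.
have eta_theta : Lsubset eta theta.
  by move=> y; exact: le_trans (sub_Lgen cL eta y) (gen_theta y).
(* Maximality among those avoiding [a] at [x] becomes maximality in [mu], since one that reaches [a]
   is [mu] by [above]. *)
have theta_max' theta' : Lsubgroup_of mu theta' -> Lsubset theta theta' ->
    theta' = theta \/ theta' = mu.
  move=> of' le'; have [x'|x'] := pselect (a <= theta' x).
    by right; apply: above => // y; exact: le_trans (eta_theta y) (le' y).
  by left; exact: theta_max.
have [[c theta_c]|theta_ncst] := pselect (exists c, forall y, theta y = c).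
  have {theta_c} E : theta = (fun=> c) by apply/funext.
  rewrite {}E in theta_of theta_x theta_max'.
  case: not_tip; apply: constant_maximal_constant_below_tip theta_max'.
    exact: theta_of.2.
  (* Here [c < a <= mu x <= mu 1]. *)
  apply: lt_le_trans (chain_ltNge wo.1 theta_x) _.
  by apply: le_trans (Lsubgroup_1 x mu_sub); exact: Frattini_sub.
(* A non-constant [theta] is a maximal L-subgroup, so it lies above [Frattini mu], whose value at
   [x] is the [a] it avoids. *)
case: (theta_x); apply: Frattini_sub_maximal; split=> //; split=> // theta_mu.
by case: theta_x; rewrite theta_mu; exact: Frattini_sub.
Qed.

End Frattini.

Theorem theorem4p6 (d : Order.disp_t) (L : tbLatticeType d) (G : groupType)
    (mu : G -> L) (L_complete : complete_lattice L)
    (L_distributive : completely_distributive L) (mu_Lsubgroup : Lsubgroup mu) :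
  Lsubset (nongenerators mu) (Frattini mu) /\
  (upper_well_ordered_chain L -> ~ constant_below_tip mu ->
    nongenerators mu = Frattini mu).
Proof.
have sub := nongenerators_sub_Frattini L_complete mu_Lsubgroup.
split=> // wo not_tip; apply: Lsubset_anti => // x.
by apply: nongenerator_le => //; exact: Frattini_nongenerator.
Qed.
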